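(* Let $r\ge1$ be an integer and define the polynomial \[ P_{01r}(x) := 4^r \sum_{m=0}^r (-1)^m \left[{r \atop m}\right] m! \sum_{1j_1+2j_2+ \cdots + m j_{m} = m} \frac{1}{j_1! j_2! \cdots j_m!} \prod_{i=1}^{m}\left(\frac{(-1)^{i-1}B_{i}}{i \cdot i!}\bigl(s_{i}(x)-x \bigr) \right)^{j_{i}}\in\mathbb{Q}[x], \] the inner sum being over tuples of nonnegative integers $(j_1,\dots,j_m)$ (for $m=0$ it consists of the empty tuple, contributing $1$). Then for every integer $N\ge r+1$, \[ P_{01r}(N)=(-1)^N N!\,(-4)^r\, r!\; C_{01(N-r)}(N), \] and $P_{01r}(x)$ is a monic polynomial of degree $2r$ having $0$ and $1$ as roots.
   Context: For an integer $N\ge1$, Rademacher's coefficients $C_{hk\ell}(N)\in\mathbb{C}$ are defined by the (unique) partial fraction decomposition $\prod_{j=1}^N \frac{1}{1-q^j}=\sum_{0\le h<k\le N,\ \gcd(h,k)=1}\ \sum_{\ell=1}^{\lfloor N/k\rfloor} \frac{C_{hk\ell}(N)}{(q-e^{2\pi i h/k})^\ell}$. The Bernoulli numbers $B_n$ are defined by $\frac{z}{e^z-1}=\sum_{n\ge0}B_n\frac{z^n}{n!}$. For $m\ge0$, $s_m(x):=\frac{1}{m+1}\sum_{j=0}^m \binom{m+1}{j+1}(-1)^{m-j}B_{m-j}x^{j+1}$, the polynomial satisfying $s_m(N)=1^m+2^m+\cdots+N^m$ for integers $N\ge0$. $\left[{r \atop m}\right]$ is the unsigned Stirling number of the first kind,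 $x(x+1)\cdots(x+r-1)=\sum_m\left[{r \atop m}\right]x^m$. *)

(* Defs.v *)
From mathcomp Require Import all_boot all_order all_algebra.
From mathcomp Require Import cyclotomic complex ring.
From mathcomp Require Import boolp classical_sets reals trigo.

Set Implicit Arguments.
Unset Strict Implicit.
Unset Printing Implicit Defensive.

Import Order.TTheory GRing.Theory Num.Theory.
Local Open Scope ring_scope.

Fixpoint bernoulli_seq (n : nat) : seq rat :=
  if n is m.+1 then
    let B := bernoulli_seq m in
    rcons B (((m == 0)%N%:R - \sum_(k < m) 'C(m.+1, k)%:R * B`_k) / m.+1%:R)
  else [::].

(* The recursion compares coefficients in
   (e^z - 1) * (\sum_n B_n z^n / n!) = z; see [bernoulli_egf]. *)
Definition bernoulli (n : nat) : rat := (bernoulli_seq n.+1)`_n.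

Definition stirling1 (r m : nat) : rat :=
  (\prod_(0 <= i < r) ('X + i%:R%:P) : {poly rat})`_m.

Definition power_sum_poly (m : nat) : {poly rat} :=
  m.+1%:R^-1 *:
    \sum_(0 <= j < m.+1)
       ('C(m.+1, j.+1)%:R * (-1) ^+ (m - j) * bernoulli (m - j)) *: 'X^(j.+1).

(* The tuple (j_1, ..., j_m) is [j] with j_i stored at index i - 1; the
   constraint on the weighted sum forces j_i <= m. *)
Definition P01 (r : nat) : {poly rat} :=
  4 ^+ r *:
    \sum_(0 <= m < r.+1)
      ((-1) ^+ m * stirling1 r m * m`!%:R) *:
        \sum_(j : {ffun 'I_m -> 'I_m.+1} | (\sum_(i < m) i.+1 * j i == m)%N)
          (\prod_(i < m) (j i)`!%:R)^-1 *:
            \prod_(i < m)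
              (((-1) ^+ i * bernoulli i.+1 / (i.+1%:R * i.+1`!%:R)) *:
                 (power_sum_poly i.+1 - 'X)) ^+ j i.

(* e^(2 pi i h / k) *)
Definition expi_frac (R : realType) (h k : nat) : R[i] :=
  let t : R := 2 * pi * h%:R / k%:R in Complex (cos t) (sin t).

(* An identity of rational functions in the indeterminate q = 'X. *)
Definition rademacher_decomposition (R : realType) (N : nat)
    (C : nat -> nat -> nat -> R[i]) : Prop :=
  let q : {fraction {poly R[i]}} := tofrac 'X in
  \prod_(1 <= j < N.+1) (1 - q ^+ j)^-1 =
  \sum_(1 <= k < N.+1) \sum_(0 <= h < k | coprime h k)
    \sum_(1 <= l < (N %/ k).+1)
      tofrac (C h k l)%:P / (q - tofrac (expi_frac R h k)%:P) ^+ l.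

(* Existence is [rademacherP], uniqueness [rademacher_unique]; the values at
   indices outside the decomposition are irrelevant. *)
Definition rademacher (R : realType) (N : nat) : nat -> nat -> nat -> R[i] :=
  xget (fun _ _ _ => 0) [set C | rademacher_decomposition N C].

Lemma size_bernoulli_seq n : size (bernoulli_seq n) = n.
Proof. by elim: n => //= n IHn; rewrite size_rcons IHn. Qed.

Lemma nth_bernoulli_seq n k : (k < n)%N -> (bernoulli_seq n)`_k = bernoulli k.
Proof.
elim: n => // n IHn; rewrite ltnS leq_eqVlt => /predU1P[->//|lt_kn].
by rewrite /= nth_rcons size_bernoulli_seq lt_kn IHn.
Qed.

Lemma bernoulli_rec n :
  \sum_(0 <= k < n.+1) 'C(n.+1, k)%:R * bernoulli k = (n == 0)%N%:R.
Proof.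
rewrite big_nat_recr //= {2}/bernoulli /= nth_rcons size_bernoulli_seq.
rewrite ltnn eqxx binSn mulrC divfK ?pnatr_eq0 //.
rewrite big_mkord addrC -[RHS](subrK (\sum_(k < n) 'C(n.+1, k)%:R * bernoulli k)).
congr (_ - _ + _); apply: eq_bigr => k _; congr (_ * _).
by rewrite nth_bernoulli_seq.
Qed.

(* The coefficient of z^n in (e^z - 1) * (\sum_k B_k z^k / k!) = z. *)
Lemma bernoulli_egf n :
  \sum_(0 <= k < n) bernoulli k / k`!%:R / (n - k)`!%:R = (n == 1)%N%:R.
Proof.
case: n => [|n]; first by rewrite big_geq.
have fn0 m : m`!%:R != 0 :> rat by rewrite pnatr_eq0 -lt0n fact_gt0.
apply: (mulIf (fn0 n.+1)); rewrite mulr_suml eqSS.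
transitivity (\sum_(0 <= k < n.+1) 'C(n.+1, k)%:R * bernoulli k).
  apply: eq_big_nat => k /andP[_ lt_kn].
  rewrite -(bin_fact (ltnW lt_kn)) !natrM; field.
  by rewrite !fn0.
by rewrite bernoulli_rec; case: n => [|n]; rewrite ?mulr1 ?mul0r.
Qed.

Lemma split_pole (K : fieldType) (c d v x : K) m : d != 0 -> x != 0 ->
  (c * d + v * x) / (x * x ^+ m * d) = c / (x * x ^+ m) + v / (x ^+ m * d).
Proof. by move=> d0 x0; field; rewrite d0 x0 /= expf_neq0. Qed.

Section PartialFractions.
Variables (F K : fieldType) (phi : {rmorphism {poly F} -> K}).
Hypothesis phi_inj : injective phi.
Variables (I : eqType) (w : I -> F) (n : I -> nat).

Let q := phi 'X.
Let L (a : F) : {poly F} := 'X - a%:P.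
Let den (s : seq I) : {poly F} := \prod_(i <- s) L (w i) ^+ n i.

Let phiL a : phi (L a) = q - phi a%:P.
Proof. exact: rmorphB. Qed.

Let phi_eq0 u : (phi u == 0) = (u == 0).
Proof. by rewrite -(inj_eq phi_inj) rmorph0. Qed.

Let phiL_neq0 a : phi (L a) != 0.
Proof. by rewrite phi_eq0 polyXsubC_eq0. Qed.

Let den_cons i s : den (i :: s) = L (w i) ^+ n i * den s.
Proof. exact: big_cons. Qed.

Let den_neq0 s : den s != 0.
Proof.
by rewrite prodf_seq_neq0; apply/allP => i _; rewrite expf_neq0 ?polyXsubC_eq0.
Qed.

Let den_root s i : i \notin s -> {in i :: s &, injective w} ->
  (den s).[w i] != 0.
Proof.
move=> nsi inj_w; rewrite horner_prod prodf_seq_neq0; apply/allP => j sj /=.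
rewrite horner_exp hornerXsubC expf_neq0 // subr_eq0.
apply: contraNneq nsi => /inj_w-> //; first exact: mem_head.
by rewrite inE sj orbT.
Qed.

Let partial_fractions_den s (u : {poly F}) :
    uniq s -> {in s &, injective w} -> (size u < size (den s))%N ->
  exists c : I -> nat -> F, phi u / phi (den s) =
    \sum_(i <- s) \sum_(1 <= l < (n i).+1)
       phi (c i l)%:P / (q - phi (w i)%:P) ^+ l.
Proof.
elim: s u => [|i s IHs] u /=.
  rewrite /den big_nil size_poly1 => _ _; rewrite ltnS leqn0 size_poly_eq0.
  by move/eqP->; exists (fun _ _ => 0); rewrite big_nil rmorph0 mul0r.
case/andP=> nsi uniq_s inj_w.
have inj_ws: {in s &, injective w}.
  by move=> j k sj sk; apply: inj_w; rewrite inE ?sj ?sk orbT.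
have gi0 := den_root nsi inj_w.
suff PF m (v : {poly F}) : (size v < size (L (w i) ^+ m * den s)%R)%N ->
    exists ci (c : I -> nat -> F), phi v / phi (L (w i) ^+ m * den s) =
      \sum_(1 <= l < m.+1) phi (ci l)%:P / (q - phi (w i)%:P) ^+ l +
      \sum_(j <- s) \sum_(1 <= l < (n j).+1)
         phi (c j l)%:P / (q - phi (w j)%:P) ^+ l.
  rewrite /den big_cons -/(den s) => /PF[ci [c ->]].
  exists (fun j => if j == i then ci else c j); rewrite big_cons eqxx.
  congr (_ + _); apply: eq_big_seq => j sj.
  by rewrite ifN //; apply: contraNneq nsi => <-.
elim: m v => [|m IHm] v ltv.
  rewrite expr0 !mul1r in ltv *.
  by have [c ->] := IHs v uniq_s inj_ws ltv; exists (fun=> 0), c; rewrite big_geq ?add0r.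
pose c0 := v.[w i] / (den s).[w i].
have /factor_theorem[v' Dv'] : root (v - c0 *: den s) (w i).
  by rewrite rootE hornerD hornerN hornerZ divfK ?subrr.
have Dv: v = c0 *: den s + v' * L (w i) by rewrite -Dv' addrC subrK.
have L0 k : L (w i) ^+ k != 0 by rewrite expf_neq0 ?polyXsubC_eq0.
have [|ci [c Dc]] := IHm v'.
  have szv : (size (v' * L (w i))%R < size (L (w i) ^+ m.+1 * den s)%R)%N.
    rewrite -Dv' (leq_ltn_trans (size_polyD _ _)) // gtn_max ltv size_polyN.
    rewrite (leq_ltn_trans (size_scale_leq _ _)) //.
    rewrite size_mul ?L0 ?den_neq0 // size_exp_XsubC.
    by rewrite -[X in (X < _)%N]add0n /= ltn_add2r.
  have [->|v'0] := eqVneq v' 0.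
    by rewrite size_poly0 size_poly_gt0 mulf_neq0 ?L0 ?den_neq0.
  have D0 : L (w i) ^+ m * den s != 0 by rewrite mulf_neq0 ?L0 ?den_neq0.
  move: szv; rewrite exprSr mulrAC !(size_mul _ (negbT (polyXsubC_eq0 _))) //.
  by rewrite size_XsubC !addn2.
exists (fun l => if l == m.+1 then c0 else ci l), c.
rewrite big_nat_recr //= eqxx.
transitivity (phi c0%:P / (q - phi (w i)%:P) ^+ m.+1 +
              phi v' / phi (L (w i) ^+ m * den s)).
  rewrite {1}Dv -mul_polyC -phiL rmorphD !rmorphM !rmorphXn exprS.
  have := phiL_neq0 (w i); have: phi (den s) != 0 by rewrite phi_eq0.
  by move=> d0 x0; rewrite split_pole.
rewrite Dc addrCA -!addrA; congr (_ + _).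
by apply: eq_big_nat => l /andP[_ ltl]; rewrite ltn_eqF.
Qed.

Lemma partial_fractions (s : seq I) (u : {poly F}) :
    let d : {poly F} := \prod_(i <- s) ('X - (w i)%:P) ^+ n i in
    uniq s -> {in s &, injective w} -> (size u < size d)%N ->
  exists c : I -> nat -> F, phi u / phi d =
    \sum_(i <- s) \sum_(1 <= l < (n i).+1)
       phi (c i l)%:P / (phi 'X - phi (w i)%:P) ^+ l.
Proof. exact: partial_fractions_den. Qed.

Let polar_sum (c : nat -> F) i :
  \sum_(1 <= l < (n i).+1) phi (c l)%:P / (q - phi (w i)%:P) ^+ l =
  phi (\sum_(1 <= l < (n i).+1) c l *: L (w i) ^+ (n i - l)) /
  phi (L (w i) ^+ n i).
Proof.
rewrite rmorph_sum mulr_suml; apply: eq_big_nat => l /andP[_].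
rewrite ltnS => lel; rewrite -mul_polyC -phiL !(rmorphM, rmorphXn) -mulrA.
congr (_ * _); rewrite -{2}(subnK lel) exprD invfM mulrA divff ?mul1r //.
by rewrite expf_neq0.
Qed.

Lemma partial_fractions_uniq s (c : I -> nat -> F) :
    uniq s -> {in s &, injective w} ->
    \sum_(i <- s) \sum_(1 <= l < (n i).+1)
       phi (c i l)%:P / (q - phi (w i)%:P) ^+ l = 0 ->
  forall i l, i \in s -> (1 <= l <= n i)%N -> c i l = 0.
Proof.
move=> uniq_s inj_w c0 i l si ln.
pose s' := rem i s.
have Es: perm_eq s (i :: s') by apply: perm_to_rem.
have nsi: i \notin s' by rewrite mem_rem_uniq // inE eqxx.
have inj_w': {in i :: s' &, injective w}.
  by move=> j k; rewrite -!(perm_mem Es); apply: inj_w.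
have gi0 := den_root nsi inj_w'.
pose p := \sum_(1 <= l < (n i).+1) (c i l) *: L (w i) ^+ (n i - l).
have [t Dt]: exists t : {poly F}, \sum_(j <- s') \sum_(1 <= l < (n j).+1)
    phi (c j l)%:P / (q - phi (w j)%:P) ^+ l = phi t / phi (den s').
  elim: (s') => [|j r [t IHr]].
    by exists 0; rewrite big_nil rmorph0 mul0r.
  pose pj := \sum_(1 <= l < (n j).+1) (c j l) *: L (w j) ^+ (n j - l).
  exists (pj * den r + t * L (w j) ^+ n j).
  rewrite big_cons IHr -/q polar_sum -/pj den_cons addf_div ?phi_eq0 //.
    by rewrite !(rmorphD, rmorphM).
  by rewrite expf_neq0 ?polyXsubC_eq0.
have: p * den s' = - t * L (w i) ^+ n i.
  move: c0; rewrite (perm_big _ Es) big_cons polar_sum -/p Dt /=.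
  rewrite addf_div ?phi_eq0 //;
    last by rewrite expf_neq0 ?polyXsubC_eq0.
  move/eqP; rewrite mulf_eq0 invr_eq0 -!rmorphM phi_eq0 mulf_eq0.
  rewrite (negPf (den_neq0 _)) expf_eq0 polyXsubC_eq0 andbF /= orbF.
  by rewrite -rmorphD phi_eq0 addr_eq0 mulNr => /eqP.
move=> Dpt; have p_dvd: L (w i) ^+ n i %| p.
  have cop: coprimep (L (w i) ^+ n i) (den s').
    by rewrite coprimep_expl // coprimep_sym coprimep_XsubC rootE.
  by rewrite -(Gauss_dvdpl _ cop) Dpt dvdp_mull.
case/dvdpP: p_dvd => v /(congr1 (fun r => (r \Po ('X + (w i)%:P))`_(n i - l))).
have LX k : (L (w i) ^+ k) \Po ('X + (w i)%:P) = 'X^k.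
  by rewrite rmorphXn /= comp_polyB comp_polyX comp_polyC addrK.
case/andP: ln => l0 ln; rewrite comp_polyM LX coefMXn ltn_subrL l0 (leq_trans l0) //.
rewrite /p raddf_sum coef_sum (bigD1_seq l) ?iota_uniq ?mem_index_iota ?l0 ?ltnS //=.
rewrite comp_polyZ LX coefZ coefXn eqxx mulr1 big_seq_cond big1 ?addr0 //= => k.
rewrite mem_index_iota ltnS => /andP[/andP[_ lekn] nkl].
rewrite comp_polyZ LX coefZ coefXn (_ : _ == _ = false) ?mulr0 //.
by apply: contraNF nkl => /eqP/(congr1 (subn (n i))); rewrite !subKn // => ->.
Qed.
End PartialFractions.

Lemma prod_invE (F K : fieldType) (phi : {rmorphism {poly F} -> K}) N :
  \prod_(1 <= j < N.+1) (1 - phi 'X ^+ j)^-1 =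
  phi ((-1) ^+ N) / phi (\prod_(1 <= j < N.+1) ('X^j - 1)).
Proof.
elim: N => [|N IHN]; first by rewrite !big_geq // rmorph1 divr1.
rewrite [LHS]big_nat_recr //= IHN [in RHS]big_nat_recr //= (exprSr (-1) N).
rewrite !rmorphM (rmorphB phi ('X^(N.+1))) (rmorphXn phi N.+1 'X) rmorph1 rmorphN1.
by rewrite -[1 - _]opprB invrN invfM mulrACA mulN1r.
Qed.

Section RademacherDecomposition.
Variable R : realType.
Local Notation C := R[i].
Local Notation rt := (expi_frac R).

Lemma expi_frac0 k : rt 0 k = 1.
Proof. by rewrite /expi_frac mulr0 mul0r cos0 sin0. Qed.

Lemma expi_frac1X h k : rt h k = rt 1 k ^+ h.
Proof.
elim: h => [|h IHh]; first by rewrite expi_frac0.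
rewrite exprSr -IHh /expi_frac /=; set c : R := 2 * pi.
rewrite -(natr1 h) (mulrDr c) mulrDl cosD sinD.
by congr Complex; rewrite addrC.
Qed.

Lemma expi_frac_scale h k d : (0 < d)%N -> rt (d * h) (d * k) = rt h k.
Proof.
move=> d_gt0; have d0: d%:R != 0 :> R by rewrite pnatr_eq0 -lt0n.
by rewrite /expi_frac !natrM mulrCA invfM mulrACA divff ?mul1r.
Qed.

Lemma expi_frac_dvd j k : (0 < j)%N -> (k %| j)%N ->
  rt 1 j ^+ (j %/ k) = rt 1 k.
Proof.
move=> j0 dvd_kj.
have jk0: (0 < j %/ k)%N.
  by rewrite (divn_gt0 _ (dvdn_gt0 j0 dvd_kj)) (dvdn_leq j0 dvd_kj).
by have := expi_frac_scale 1 k jk0; rewrite muln1 divnK // expi_frac1X.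
Qed.

Lemma expi_frac_prim k : (0 < k)%N -> k.-primitive_root (rt 1 k).
Proof.
move=> k_gt0; have k0: k%:R != 0 :> R by rewrite pnatr_eq0 -lt0n.
have rtk : rt 1 k ^+ k = 1.
  by rewrite -expi_frac1X /expi_frac mulfK // mulr_natl cos2pi sin2pi.
have [m prim_m m_dvd] := prim_order_exists k_gt0 rtk.
have m_gt0 := prim_order_gt0 prim_m.
have := dvdn_leq k_gt0 m_dvd; rewrite leq_eqVlt => /predU1P[Ek|lt_mk].
  by rewrite -{1}Ek.
have /(congr1 (@complex.Re R)) /= := prim_expr_order prim_m.
rewrite -expi_frac1X /=.
have -> : 2 * pi * m%:R / k%:R = (pi * (m%:R / k%:R)) *+ 2 :> R.
  by rewrite -[RHS]mulr_natl !mulrA.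
move=> cos1; suff: 0 < sin (pi * (m%:R / k%:R)) :> R.
  have := cos2Dsin2 (pi * (m%:R / k%:R) : R).
  move: cos1; rewrite cos_mulr2n => /(canRL (subrK _)) cos1.
  have -> : cos (pi * (m%:R / k%:R)) ^+ 2 = 1 :> R.
    by apply: (mulIf (_ : 2 != 0)); rewrite ?pnatr_eq0 // mulr_natr cos1 mul1r.
  move/(canRL (addKr _)); rewrite addNr => /eqP; rewrite expf_eq0 /= => /eqP->.
  by rewrite ltxx.
apply: sin_gt0_pi; rewrite mulr_gt0 ?pi_gt0 ?divr_gt0 ?ltr0n //=.
by rewrite gtr_pMr ?pi_gt0 // ltr_pdivrMr ?ltr0n // mul1r ltr_nat.
Qed.

Let fareys N : seq (nat * nat) :=
  [seq (h, k) | k <- index_iota 1 N.+1, h <- [seq h <- index_iota 0 k | coprime h k]].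

Let w (p : nat * nat) : C := rt p.1 p.2.

Let mem_fareys N p :
  p \in fareys N -> [/\ (0 < p.2)%N, (p.2 <= N)%N, (p.1 < p.2)%N & coprime p.1 p.2].
Proof.
case/allpairsPdep=> k [h [+ + ->]] /=; rewrite mem_filter !mem_index_iota ltnS.
by case/andP=> -> -> /andP[-> /=].
Qed.

Let fareysP N h k : (0 < k <= N)%N -> (h < k)%N -> coprime h k ->
  (h, k) \in fareys N.
Proof.
move=> kN hk co_hk; apply/allpairsPdep; exists k, h.
by rewrite mem_filter !mem_index_iota ltnS co_hk hk.
Qed.

Let fareys_uniq N : uniq (fareys N).
Proof.
apply: allpairs_uniq_dep => [|k _|]; rewrite ?filter_uniq ?iota_uniq //.
by move=> [k h] [k' h'] _ _ /= [-> ->].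
Qed.

Let fareys_inj N : {in fareys N &, injective w}.
Proof.
move=> [h k] [h' k'] /mem_fareys[/= k0 _ hk co] /mem_fareys[/= k'0 _ hk' co'].
rewrite /w /= => Ew.
have pk: k.-primitive_root (rt h k).
  by rewrite expi_frac1X prim_root_exp_coprime // expi_frac_prim.
have pk': k'.-primitive_root (rt h' k').
  by rewrite expi_frac1X prim_root_exp_coprime // expi_frac_prim.
have Ek: k = k'.
  apply/eqP; rewrite eqn_dvd (prim_order_dvd pk) (prim_order_dvd pk') {1}Ew -Ew.
  by rewrite Ew (prim_expr_order pk') -Ew (prim_expr_order pk) eqxx.
subst k'; move/eqP: Ew; rewrite (expi_frac1X h) (expi_frac1X h').
by rewrite (eq_prim_root_expr (expi_frac_prim k0)) !modn_small // => /eqP->.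
Qed.

Let den N : {poly C} := \prod_(p <- fareys N) ('X - (w p)%:P) ^+ (N %/ p.2).

Let big_fareys (T : Type) (idx : T) (op : Monoid.com_law idx) N (G : nat -> nat -> T) :
  \big[op/idx]_(1 <= k < N.+1) \big[op/idx]_(0 <= h < k | coprime h k) G h k =
  \big[op/idx]_(p <- fareys N) G p.1 p.2.
Proof.
rewrite big_allpairs_dep; apply: eq_bigr => k _.
by rewrite big_filter.
Qed.

Let prod_Xn_sub1 N : \prod_(1 <= j < N.+1) ('X^j - 1) = den N.
Proof.
rewrite /den -(big_fareys _ N (fun h k => ('X - (rt h k)%:P) ^+ (N %/ k))).
transitivity (\prod_(1 <= j < N.+1) \prod_(1 <= k < N.+1 | (k %| j)%N)
                cyclotomic (rt 1 k) k).
  apply: eq_big_nat => j /andP[j0 jN].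
  rewrite (prod_cyclotomic (expi_frac_prim j0)) -[RHS]big_filter.
  rewrite (perm_big [seq k <- index_iota 1 N.+1 | (k %| j)%N]) /=; last first.
    apply: uniq_perm; rewrite ?divisors_uniq ?filter_uniq ?iota_uniq // => k.
    rewrite mem_filter -dvdn_divisors // mem_index_iota.
    case dvd_kj: (k %| j)%N => //=; rewrite (dvdn_gt0 j0 dvd_kj) ltnS.
    by rewrite (leq_trans (dvdn_leq j0 dvd_kj)).
  apply: (@eq_big_seq _ _ _ _ _ (fun k => cyclotomic (rt 1 j ^+ (j %/ k)) k)) => k.
  by rewrite mem_filter => /andP[dvd_kj _]; rewrite expi_frac_dvd.
rewrite (exchange_big_dep predT) //=; apply: eq_big_nat => k /andP[k0 kN].
rewrite prodrXl; set x := cyclotomic _ _.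
transitivity (\prod_(1 <= j < N.+1) x ^+ (k %| j)%N).
  by rewrite big_mkcond; apply: eq_bigr => j _; case: (k %| j)%N.
rewrite -expr_sum -divn_count_dvd /x /cyclotomic big_mkord; congr (_ ^+ _).
by apply: eq_bigr => h _; rewrite -expi_frac1X.
Qed.

Let lhsE N :
  \prod_(1 <= j < N.+1) (1 - tofrac 'X ^+ j)^-1 =
  tofrac ((-1) ^+ N) / tofrac (den N) :> {fraction {poly C}}.
Proof.
rewrite -prod_Xn_sub1; exact: prod_invE.
Qed.

Let decompositionE N c :
  rademacher_decomposition N c <->
  tofrac ((-1) ^+ N) / tofrac (den N) =
  \sum_(p <- fareys N) \sum_(1 <= l < (N %/ p.2).+1)
    tofrac (c p.1 p.2 l)%:P / (tofrac 'X - tofrac (w p)%:P) ^+ l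
    :> {fraction {poly C}}.
Proof.
rewrite /rademacher_decomposition; cbv zeta; rewrite lhsE.
by rewrite (big_fareys _ N (fun h k => \sum_(1 <= l < (N %/ k).+1)
  tofrac (c h k l)%:P / (tofrac 'X - tofrac (rt h k)%:P) ^+ l)).
Qed.

Lemma rademacher_exists N : (0 < N)%N ->
  exists c, rademacher_decomposition (R := R) N c.
Proof.
move=> N_gt0.
have den0 : den N != 0.
  by rewrite prodf_seq_neq0; apply/allP => p _; rewrite expf_neq0 ?polyXsubC_eq0.
have fr_inj : injective (@tofrac {poly C}).
  by move=> u v /eqP; rewrite tofrac_eq => /eqP.
have den_gt1 : (1 < size (den N))%N.
  apply: (root_size_gt1 (a := 1)) => //.
  rewrite -dvdp_XsubCl -prod_Xn_sub1 (big_cat_nat _ (n := 2)) //= big_nat1.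
  by rewrite expr1 dvdp_mulr.
have sgn_lt : (size ((-1) ^+ N : {poly C}) < size (den N))%N.
  rewrite -signr_odd; case: (odd N); rewrite ?expr0 ?expr1 ?size_polyN size_poly1 //.
have [c Dc] := @partial_fractions _ _ (@tofrac {poly C}) fr_inj _ w
  (fun p => N %/ p.2)%N _ _ (fareys_uniq N) (@fareys_inj N) sgn_lt.
by exists (fun h k l => c (h, k) l); apply/decompositionE; rewrite Dc;
   apply: eq_bigr => -[h k] _.
Qed.

Lemma rademacher_unique N c c' :
    rademacher_decomposition (R := R) N c ->
    rademacher_decomposition (R := R) N c' ->
  forall h k l, (h < k <= N)%N -> coprime h k -> (1 <= l <= N %/ k)%N ->
  c h k l = c' h k l.
Proof.
move=> /decompositionE Dc /decompositionE Dc' h k l /andP[hk kN] co_hk ln.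
have fr_inj : injective (@tofrac {poly C}).
  by move=> u v /eqP; rewrite tofrac_eq => /eqP.
have hkF : (h, k) \in fareys N by rewrite fareysP // kN (leq_ltn_trans _ hk).
apply/eqP; rewrite -subr_eq0; apply/eqP.
apply: (@partial_fractions_uniq _ _ (@tofrac {poly C}) fr_inj _ w
  (fun p => N %/ p.2)%N _ (fun p l => c p.1 p.2 l - c' p.1 p.2 l)
  (fareys_uniq N) (@fareys_inj N) _ _ _ hkF ln).
move/eqP: Dc; rewrite Dc' eq_sym -subr_eq0 -sumrB => /eqP Dcc.
rewrite -[RHS]Dcc; apply: eq_bigr => p _; rewrite -sumrB; apply: eq_bigr => i _.
rewrite -mulrBl; congr (_ / _).
exact: etrans (congr1 _ (polyCB _ _)) (tofracB _ _).
Qed.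

End RademacherDecomposition.

Lemma rademacherP (R : realType) N : (0 < N)%N ->
  rademacher_decomposition N (rademacher R N).
Proof. by move=> N_gt0; apply: xgetPex; apply: rademacher_exists. Qed.

(* Main.v *)
(* Put [t = q - 1] and [z = log q].  Since [log ((e^z - 1) / z)] has the
   expansion [\sum_i (-1)^i B_i z^i / (i i!)], the series
   [F z = exp (\sum_i (-1)^(i-1) B_i / (i i!) (s_i N - N) z^i)] equals
   [\prod_(j <= N) j z / (e^(j z) - 1)] times [((e^z - 1) / z)^N].  As
   [e^z - 1 = t], this says that [\prod_(j <= N) 1 / (1 - q^j)] is
   [(-1)^N / N! t^(-N) F (log (1 + t))], so that [C_(01(N-r)) (N)] is
   [(-1)^N / N!] times the coefficient of [t^r] in [F (log (1 + t))].  The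
   Stirling numbers are the coefficients of the powers of [log (1 + t)].

   Power series are polynomials modulo ['X^n], and identities between them are
   obtained by comparing logarithmic derivatives.  The recursion
   [m f_m = \sum_i i a_i f_(m-i)] for the coefficients of
   [exp (\sum_i a_i z^i)], applied to polynomial coefficients [a_i],
   also yields the degree and the leading term: [s_i - x] has degree [i + 1],
   which is less than [2 i] unless [i = 1]. *)

Require Import Defs.
From mathcomp Require Import all_boot all_order all_algebra.
From mathcomp Require Import complex reals.
From mathcomp Require Import ring zify.
Import GRing.Theory Num.Theory.
Local Open Scope ring_scope.

Set Implicit Arguments.
Unset Strict Implicit.
Unset Printing Implicit Defensive.

(** * Congruence of polynomials modulo ['X^n] *)

Section CongruenceModXn.
Context {A : comNzRingType}.
Implicit Types (p q u v c d : {poly A}) (n : nat).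

Definition eqmodX n p q := forall i, (i < n)%N -> p`_i = q`_i.

Lemma eqmodX_refl n p : eqmodX n p p. Proof. by []. Qed.

Lemma eqmodX_sym n p q : eqmodX n p q -> eqmodX n q p.
Proof. by move=> pq i /pq. Qed.

Lemma eqmodX_trans n p q u : eqmodX n p q -> eqmodX n q u -> eqmodX n p u.
Proof. by move=> pq qu i lt_in; rewrite pq ?qu. Qed.

Lemma eqmodX_leq m n p q : (m <= n)%N -> eqmodX n p q -> eqmodX m p q.
Proof. by move=> le_mn pq i lt_im; rewrite pq ?(leq_trans lt_im). Qed.

Lemma eqmodXD n p q u v :
  eqmodX n p q -> eqmodX n u v -> eqmodX n (p + u) (q + v).
Proof. by move=> pq uv i lt_in; rewrite !coefD pq ?uv. Qed.

Lemma eqmodXB n p q u v :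
  eqmodX n p q -> eqmodX n u v -> eqmodX n (p - u) (q - v).
Proof. by move=> pq uv i lt_in; rewrite !coefB pq ?uv. Qed.

Lemma eqmodXM n p q u v :
  eqmodX n p q -> eqmodX n u v -> eqmodX n (p * u) (q * v).
Proof.
move=> pq uv i lt_in; rewrite !coefM; apply: eq_bigr => j _.
by rewrite pq ?uv // (leq_ltn_trans _ lt_in) ?leq_subr // -ltnS.
Qed.

Lemma eqmodX_exp n p q k : eqmodX n p q -> eqmodX n (p ^+ k) (q ^+ k).
Proof.
by move=> pq; elim: k => // k IHk; rewrite !exprS; apply: eqmodXM.
Qed.

Lemma eqmodX_prod n (I : Type) (s : seq I) (f g : I -> {poly A}) :
  (forall i, eqmodX n (f i) (g i)) ->
  eqmodX n (\prod_(i <- s) f i) (\prod_(i <- s) g i).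
Proof.
move=> fg; elim: s => [|i s IHs]; first by rewrite !big_nil.
by rewrite !big_cons; apply: eqmodXM.
Qed.

Lemma eqmodX_MXn n k p q :
  eqmodX (n + k) (p * 'X^k) (q * 'X^k) <-> eqmodX n p q.
Proof.
split=> pq i lt_in.
  by have := pq (i + k)%N; rewrite !coefMXn ltn_add2r lt_in ltnNge leq_addl addnK; apply.
rewrite !coefMXn; case: ltnP => // le_ki; apply: pq.
by rewrite ltn_subLR // addnC.
Qed.

Lemma eqmodX_dvd n p q r : p = q + r * 'X^n -> eqmodX n p q.
Proof. by move=> -> i lt_in; rewrite coefD coefMXn lt_in addr0. Qed.

(** Since [u] has no constant term, it is a multiple of ['X], so substituting it sends multiples of
    ['X^n] to multiples of ['X^n]. *)
Lemma eqmodX_comp n p q u :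
  u`_0 = 0 -> eqmodX n p q -> eqmodX n (p \Po u) (q \Po u).
Proof.
move=> u0 pq.
have Du: u = drop_poly 1 u * 'X.
  rewrite -[LHS](poly_take_drop 1 u) [X in X + _](_ : _ = 0) ?add0r //.
  by apply/polyP=> -[|i]; rewrite coef_take_poly coef0.
have Dp: p = q + drop_poly n (p - q) * 'X^n.
  rewrite -[LHS](subrK q) addrC; congr (_ + _).
  rewrite -[LHS](poly_take_drop n) [X in X + _](_ : _ = 0) ?add0r //.
  apply/polyP=> i; rewrite coef_take_poly coef0; case: ifP => // /pq.
  by rewrite coefB => ->; rewrite subrr.
apply: (@eqmodX_dvd _ _ _ ((drop_poly n (p - q) \Po u) * drop_poly 1 u ^+ n)).
by rewrite -mulrA -exprMn -Du [in LHS]Dp comp_polyD comp_polyM comp_Xn_poly.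
Qed.

(** Here [c] plays the role of z u'/u. Clearing the denominator avoids inverting [u], and the factor
    ['X] compensates for the order of precision that a derivative loses. *)
Definition logder n c u := eqmodX n ('X * u^`()) (c * u).

Lemma logder1 n : logder n 0 1.
Proof. by rewrite /logder derivC mulr0 mul0r. Qed.

Lemma logder_eq n c d u : eqmodX n c d -> logder n c u -> logder n d u.
Proof.
by move=> cd /eqmodX_trans; apply; apply: eqmodXM.
Qed.

Lemma logderM n c d u v : logder n c u -> logder n d v -> logder n (c + d) (u * v).
Proof.
move=> cu dv; rewrite /logder derivM.
rewrite (_ : 'X * _ = 'X * u^`() * v + u * ('X * v^`())); last by ring.
rewrite (_ : _ * (u * v) = c * u * v + u * (d * v)); last by ring.
by apply: eqmodXD; apply: eqmodXM.
Qed.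

Lemma logder_prod n (I : Type) (s : seq I) (c u : I -> {poly A}) :
  (forall i, logder n (c i) (u i)) ->
  logder n (\sum_(i <- s) c i) (\prod_(i <- s) u i).
Proof.
move=> cu; elim: s => [|i s IHs]; first by rewrite !big_nil; apply: logder1.
by rewrite !big_cons; apply: logderM.
Qed.

End CongruenceModXn.

(** The coefficient of z^(i+1) in z u' is (i+1) u_(i+1), whereas in c u it involves only u_0, ...,
    u_i because c_0 = 0. Dividing by i+1 in a rational algebra determines [u] from its constant
    term. *)
Lemma logder_uniq (A : comAlgType rat) n (c u v : {poly A}) :
    c`_0 = 0 -> u`_0 = v`_0 -> logder n c u -> logder n c v -> eqmodX n u v.
Proof.
move=> c0 uv0 cu cv; elim/ltn_ind => -[//|i] IHi lt_in.
have := cu i.+1 lt_in; have := cv i.+1 lt_in.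
rewrite !coefXM !coef_deriv /= !coefM !(big_ord_recl i.+1) /= c0 !mul0r !add0r.
move=> Dv Du; have scaleK (x : A) : (i.+1%:R^-1 : rat) *: (x *+ i.+1) = x.
  by rewrite -scaler_nat scalerA mulVf ?pnatr_eq0 ?scale1r.
rewrite -[LHS]scaleK -[RHS]scaleK Du Dv; congr (_ *: _); apply: eq_bigr => j _.
rewrite /bump /= add1n subSS IHi ?ltnS ?leq_subr //.
by rewrite (leq_ltn_trans _ lt_in) ?leqW ?leq_subr.
Qed.

(** * The exponential formula *)

Section ExponentialFormula.
Context {A : comAlgType rat}.
Implicit Types (a : nat -> A) (m n : nat).

(* The coefficient of [z^m] in [exp (\sum_i a_i z^(i+1))]. *)
Definition exp_coef a m : A :=
  \sum_(j : {ffun 'I_m -> 'I_m.+1} | (\sum_(i < m) i.+1 * j i == m)%N)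
    (\prod_(i < m) (j i)`!%:R)^-1 *: \prod_(i < m) a i ^+ j i.

(** A truncation of exp(x z^(i+1)). *)
Definition exp_monomial n (x : A) i : {poly A} :=
  \sum_(k < n.+1) ((k`!%:R^-1 : rat) *: x ^+ k) *: 'X^(i.+1 * k).

(** Expanding the product of sums gives one monomial for each choice of exponents [j], and its
    degree is the weighted sum that [exp_coef] constrains to be m. *)
Lemma coef_prod_exp_monomial a m :
  (\prod_(i < m) exp_monomial m (a i) i)`_m = exp_coef a m.
Proof.
rewrite bigA_distr_bigA coef_sum /exp_coef [RHS]big_mkcond; apply: eq_bigr => j _.
have ->: \prod_(i < m) ((((j i)`!%:R^-1 : rat) *: a i ^+ j i) *: 'X^(i.+1 * j i)) =
   ((\prod_(i < m) (j i)`!%:R)^-1 *: \prod_(i < m) a i ^+ j i) *: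
     'X^(\sum_(i < m) i.+1 * j i).
  by rewrite !scaler_prod prodfV expr_sum.
rewrite coefZ coefXn eq_sym; case: eqP; rewrite ?mulr1 ?mulr0 //.
Qed.

Lemma logder_exp_monomial n (x : A) i :
  logder n.+1 ((i.+1%:R * x) *: 'X^(i.+1)) (exp_monomial n x i).
Proof.
pose c k : A := ((k`!%:R^-1 : rat) *: x ^+ k).
have cS k : c k.+1 *+ k.+1 = x * c k.
  rewrite /c exprS scalerMnl factS natrM invfM -mulr_natr mulrAC mulVf ?pnatr_eq0 //.
  by rewrite mul1r scalerAr.
(* Differentiation shifts the summation index by one, so the two sides differ only in the last term
   of the truncation, whose degree (i+1)(n+1) is at least n+1. *)
apply: eqmodX_sym; apply: (@eqmodX_dvd _ _ _ _
  ((i.+1%:R * x * c n) *: 'X^(i.+1 * n.+1 - n.+1))).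
rewrite -[X in _ + X]scalerAl -exprD subnK ?leq_pmull //.
rewrite /exp_monomial [in LHS]big_ord_recr /= mulrDr; congr (_ + _); last first.
  by rewrite -scalerAl -scalerAr scalerA -exprD -mulnS.
rewrite big_ord_recl derivD muln0 alg_polyC derivC add0r raddf_sum !mulr_sumr.
apply: eq_bigr => k _; rewrite -[X in 'X * X]/(deriv _) derivZ derivXn lift0.
rewrite -scalerAl -!scalerAr scalerA -exprD -mulnS -/(c k) -/(c k.+1).
rewrite mulrnAr -scalerMnr -exprS prednK ?muln_gt0 // scalerMnl mulnC.
by rewrite mulrnA cS -mulrA mulr_natl [(k.+1 * _)%N]mulnC.
Qed.

Let coef0_prod_exp_monomial n m a : (\prod_(i < m) exp_monomial n (a i) i)`_0 = 1.
Proof.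
rewrite -horner_coef0 horner_prod big1 // => i _.
rewrite horner_coef0 coef_sum big_ord_recl muln0 coefZ coefXn eqxx mulr1.
rewrite invr1 scale1r big1 ?addr0 // => k _.
by rewrite coefZ coefXn mulr0.
Qed.

(** The factor of index i contributes (i+1) a_i z^(i+1), so the factors with i >= m are invisible
    modulo z^(m+1). Hence one product, with n large, yields all the [exp_coef a m] with m <= n. *)
Let logder_prod_exp_monomial n m a : (m <= n)%N ->
  logder m.+1 (\poly_(k < m.+1) (k%:R * a k.-1))
    (\prod_(i < n) exp_monomial n (a i) i).
Proof.
move=> le_mn; have le_mn1 : (m.+1 <= n.+1)%N by [].
have := logder_prod (index_enum 'I_n) (fun i => @logder_exp_monomial n (a i) i).
move/(eqmodX_leq le_mn1); apply: logder_eq => -[|i] lt_im.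
  (* In degree 0 the meaningless entry [a 0.-1] is multiplied by 0. *)
  rewrite coef_sum coef_poly mul0r big1 // => i _.
  by rewrite coefZ coefXn mulr0.
have lt_in : (i < n)%N by exact: leq_trans (lt_im : (i < m)%N) le_mn.
rewrite coef_poly lt_im /= coef_sum (bigD1 (Ordinal lt_in)) //=.
rewrite coefZ coefXn eqxx mulr1 big1 ?addr0 // => k ne_ki.
rewrite coefZ coefXn eqSS (_ : i == k = false) ?mulr0 //.
by apply: contraNF ne_ki => /eqP Di; apply/eqP/val_inj.
Qed.

Let exp_coefE m n a : (m <= n)%N ->
  exp_coef a m = (\prod_(i < n) exp_monomial n (a i) i)`_m.
Proof.
move=> le_mn; rewrite -coef_prod_exp_monomial.
apply: logder_uniq (logder_prod_exp_monomial a (leqnn m))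
  (logder_prod_exp_monomial a le_mn) _ (leqnn _).
  by rewrite coef_poly mul0r.
by rewrite !coef0_prod_exp_monomial.
Qed.

Lemma exp_coef0 a : exp_coef a 0 = 1.
Proof. by rewrite (exp_coefE a (leqnn 0)) coef0_prod_exp_monomial. Qed.

Lemma logder_exp_coef n a :
  logder n.+1 (\poly_(k < n.+1) (k%:R * a k.-1)) (\poly_(m < n.+1) exp_coef a m).
Proof.
have Dexp : eqmodX n.+1 (\prod_(i < n) exp_monomial n (a i) i)
                        (\poly_(m < n.+1) exp_coef a m).
  by move=> m lt_mn; rewrite coef_poly lt_mn -exp_coefE.
move=> m lt_mn; have := logder_prod_exp_monomial a (leqnn n) lt_mn.
rewrite (eqmodXM (eqmodX_refl _) Dexp lt_mn) => <-.
rewrite !coefXM !coef_deriv; case: m lt_mn => //= m lt_mn.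
by rewrite Dexp.
Qed.

Lemma exp_coef_rec m a :
  exp_coef a m.+1 *+ m.+1 = \sum_(i < m.+1) i.+1%:R * a i * exp_coef a (m - i).
Proof.
have := logder_exp_coef a (leqnn m.+2).
rewrite coefXM coef_deriv coef_poly leqnn /= => ->.
rewrite coefM big_ord_recl coef_poly !mul0r add0r; apply: eq_bigr => i _.
rewrite !coef_poly lift0 /= subSS ltnS ltn_ord.
by rewrite ltnS leqW ?leq_subr.
Qed.

End ExponentialFormula.

(** Applied to evaluation at x = N, this specializes the polynomial coefficients of F to rational
    ones. *)
Lemma exp_coef_map (A B : comAlgType rat) (phi : {lrmorphism A -> B}) a m :
  phi (exp_coef a m) = exp_coef (fun i => phi (a i)) m.
Proof.
rewrite rmorph_sum; apply: eq_bigr => j _.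
rewrite /= linearZ_LR rmorph_prod; congr (_ *: _).
by apply: eq_bigr => i _; rewrite rmorphXn.
Qed.

(** * Exponential and Bernoulli series *)

Lemma logder_uniq_rat n (c u v : {poly rat}) :
    c`_0 = 0 -> u`_0 = v`_0 -> logder n c u -> logder n c v -> eqmodX n u v.
Proof. exact: (@logder_uniq rat^o). Qed.

Section ExponentialSeries.
Implicit Types (c d : rat) (n : nat).

Definition exp_series n c : {poly rat} := \poly_(k < n) (c ^+ k / k`!%:R).

(* [(exp (c z) - 1) / (c z)] *)
Definition exp_quotient n c : {poly rat} := \poly_(k < n) (c ^+ k / k.+1`!%:R).

(* [- c z / (exp (- c z) - 1)] *)
Definition bernoulli_series n c : {poly rat} :=
  \poly_(k < n) ((-1) ^+ k * bernoulli k / k`!%:R * c ^+ k).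

Let fact_neq0 k : k`!%:R != 0 :> rat.
Proof. by rewrite pnatr_eq0 -lt0n fact_gt0. Qed.

Lemma logder_exp_series n c : logder n (c *: 'X) (exp_series n c).
Proof.
move=> [|k] lt_kn; rewrite -scalerAl coefZ !coefXM ?mulr0 //= coef_deriv.
rewrite !coef_poly lt_kn (ltnW lt_kn) -mulr_natr factS natrM exprS.
by field; rewrite fact_neq0 nat1r pnatr_eq0.
Qed.

Let expX0 c : (c *: 'X : {poly rat})`_0 = 0.
Proof. by rewrite coefZ coefX mulr0. Qed.

Let exp_series0 n c : (0 < n)%N -> (exp_series n c)`_0 = 1.
Proof. by move=> n_gt0; rewrite coef_poly n_gt0 divr1. Qed.

Lemma exp_seriesD n c d :
  eqmodX n (exp_series n (c + d)) (exp_series n c * exp_series n d).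
Proof.
case: n => // n.
apply: (logder_uniq_rat (expX0 (c + d)) _ (logder_exp_series _)).
  by rewrite coef0M !exp_series0 ?mul1r.
by rewrite scalerDl; apply: logderM; apply: logder_exp_series.
Qed.

Lemma exp_seriesE n c :
  exp_series n.+1 c - 1 = c *: ('X * exp_quotient n c).
Proof.
apply/polyP=> k; rewrite coefB coef1 coefZ coefXM !coef_poly.
case: k => [|k]; first by rewrite divr1 subrr mulr0.
rewrite subr0 ltnS; case: ifP => _; rewrite ?mulr0 //= exprS; field.
by rewrite fact_neq0.
Qed.

(** This is e^z - 1 = - (e^(-z) - 1) e^z divided by z; the division is why the proof works modulo
    z^(n+1). *)
Lemma exp_quotientV n :
  eqmodX n (exp_quotient n 1) (exp_quotient n (-1) * exp_series n.+1 1).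
Proof.
have D1 := exp_seriesE n 1; have DN := exp_seriesE n (-1).
rewrite scale1r in D1; rewrite scaleN1r in DN.
have: eqmodX n.+1 ('X * exp_quotient n 1)
                  ('X * (exp_quotient n (-1) * exp_series n.+1 1)).
  rewrite mulrA -[X in X * exp_series _ _]opprK -DN -D1 opprB mulrBl mul1r.
  apply: eqmodXB; first exact: eqmodX_refl.
  apply: eqmodX_trans (exp_seriesD _ _); rewrite addNr => k lt_kn.
  by rewrite coef1 coef_poly lt_kn; case: k {lt_kn} => [|k]; rewrite ?divr1 // exprS !mul0r.
by move=> D; apply/(@eqmodX_MXn _ n 1); rewrite addn1 expr1 ![_ * 'X]mulrC.
Qed.

Lemma bernoulli_series_quotientN n :
  eqmodX n (bernoulli_series n 1 * exp_quotient n (-1)) 1.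
Proof.
move=> k lt_kn; rewrite coef1 coefM.
have := bernoulli_egf k.+1; rewrite eqSS big_mkord => Bk.
(* Pulling out the sign (-1)^k leaves the recurrence [bernoulli_egf] in degree k+1. *)
transitivity ((-1) ^+ k * (k == 0)%:R : rat); last by case: (k) => [|i]; rewrite ?mul1r ?mulr0.
rewrite -Bk mulr_sumr; apply: eq_bigr => i _.
have le_ik : (i <= k)%N by rewrite -ltnS.
rewrite !coef_poly (leq_ltn_trans le_ik) // (leq_ltn_trans (leq_subr _ _)) //.
have -> : (-1) ^+ k = (-1) ^+ (k - i) * (-1) ^+ i :> rat by rewrite -exprD subnK.
by rewrite expr1n mulr1 -(subSn le_ik); field; rewrite !fact_neq0.
Qed.

Lemma bernoulli_series_quotient n :
  eqmodX n (bernoulli_series n 1 * exp_quotient n 1) (exp_series n 1).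
Proof.
have D := eqmodXM (@eqmodX_refl _ n (bernoulli_series n 1)) (@exp_quotientV n).
apply: eqmodX_trans D _; rewrite mulrA -[exp_series n 1]mul1r.
apply: eqmodXM (@bernoulli_series_quotientN n) _ => k lt_kn.
by rewrite !coef_poly lt_kn ltnW.
Qed.

(** For u = (e^(cz) - 1)/(cz) one has z u' + u = (z u)' = e^(cz), and the Bernoulli series times u
    is e^(cz) as well. The second fact follows from the case c = 1, the coefficients of z^k on both
    sides being scaled by c^k. *)
Lemma logder_exp_quotient n c :
  logder n (bernoulli_series n c - 1) (exp_quotient n c).
Proof.
move=> k lt_kn; rewrite mulrBl mul1r coefB; apply/eqP; rewrite eq_sym subr_eq.
apply/eqP; transitivity (c ^+ k / k`!%:R).
  have := bernoulli_series_quotient lt_kn; rewrite !coefM coef_poly lt_kn expr1n div1r.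
  move=> <-; rewrite mulr_sumr; apply: eq_bigr => i _.
  have le_ik : (i <= k)%N by rewrite -ltnS.
  rewrite !coef_poly (leq_ltn_trans le_ik) // (leq_ltn_trans (leq_subr _ _)) //.
  have -> : c ^+ k = c ^+ (k - i) * c ^+ i by rewrite -exprD subnK.
  by rewrite !expr1n; ring.
rewrite coefXM coef_deriv !coef_poly lt_kn; case: k lt_kn => [|k] lt_kn /=.
  by rewrite add0r.
rewrite lt_kn factS -mulr_natr (natrM _ k.+2); field.
by rewrite fact_neq0 nat1r -natrD !pnatr_eq0.
Qed.

(** The exponential generating function of the s_m(c) is (e^(cz) - 1)/(1 - e^(-z)), written as c
    times -z/(e^(-z) - 1) times (e^(cz) - 1)/(cz). *)
Lemma power_sum_poly_coef n c m : (m < n)%N ->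
  (power_sum_poly m).[c] = m`!%:R * (c *: (bernoulli_series n 1 * exp_quotient n c))`_m.
Proof.
move=> lt_mn; rewrite /power_sum_poly hornerZ horner_sum coefZ coefMr.
rewrite big_mkord !mulr_sumr; apply: eq_bigr => i _.
have le_im : (i <= m)%N by rewrite -ltnS.
rewrite !coef_poly (leq_ltn_trans le_im) // (leq_ltn_trans (leq_subr _ _)) //.
rewrite hornerZ hornerXn expr1n exprS mulr1.
have := congr1 (fun k => k%:R : rat) (bin_fact (le_im : (i.+1 <= m.+1)%N)).
rewrite subSS 2!natrM [in RHS]factS natrM => Dbin.
have m0 : m.+1%:R != 0 :> rat by rewrite pnatr_eq0.
have -> : m`!%:R = 'C(m.+1, i.+1)%:R * (i.+1`!%:R * (m - i)`!%:R) / m.+1%:R :> rat.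
  by rewrite Dbin mulrAC divff ?mul1r.
by field; rewrite nat1r !fact_neq0.
Qed.

(** On generating functions, (e^((c+1)z) - e^(cz))/(1 - e^(-z)) = e^((c+1)z). *)
Lemma power_sum_polyS m c :
  (power_sum_poly m).[c + 1] = (power_sum_poly m).[c] + (c + 1) ^+ m.
Proof.
pose n := m.+1; have lt_mn : (m < n)%N := ltnSn m.
rewrite !(power_sum_poly_coef _ lt_mn) -[X in _ = _ + X](mulVKf (fact_neq0 m)).
rewrite -mulrDr; congr (_ * _); apply/eqP; rewrite -subr_eq0 opprD addrA subr_eq0 -coefB; apply/eqP.
transitivity (exp_series n (c + 1))`_m; last by rewrite coef_poly lt_mn mulrC.
move: (m) lt_mn; rewrite -/(eqmodX n _ _).
apply: eqmodX_trans (eqmodX_sym (exp_seriesD _ _)).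
have expS d : eqmodX n (exp_series n.+1 d) (exp_series n d).
  by move=> k lt_kn; rewrite !coef_poly lt_kn ltnW.
apply: eqmodX_trans (eqmodXM (expS _) (@bernoulli_series_quotient n)).
(* After multiplication by z the quotients become differences of exponentials, by the exact identity
   [exp_seriesE]. *)
apply/(@eqmodX_MXn _ n 1); rewrite addn1 expr1.
rewrite (_ : _ * 'X = bernoulli_series n 1 * (exp_series n.+1 (c + 1) - exp_series n.+1 c)).
  rewrite (_ : _ * 'X = bernoulli_series n 1 * (exp_series n.+1 c * (exp_series n.+1 1 - 1))).
    apply: eqmodXM; first exact: eqmodX_refl.
    rewrite mulrBr mulr1; apply: eqmodXB; last exact: eqmodX_refl.
    exact: exp_seriesD.
  by rewrite exp_seriesE scale1r; ring.
rewrite (_ : exp_series _ _ - _ = exp_series n.+1 (c + 1) - 1 - (exp_series n.+1 c - 1)); last by ring.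
rewrite !exp_seriesE mulrBr.
by rewrite -!scalerAr !mulrBl -!scalerAl; congr (_ *: _ - _ *: _); ring.
Qed.

Lemma power_sum_poly0 m : (power_sum_poly m).[0] = 0.
Proof. by rewrite (power_sum_poly_coef _ (ltnSn m)) scale0r coef0 mulr0. Qed.

Lemma power_sum_poly_nat m N :
  (power_sum_poly m).[N%:R] = \sum_(0 <= j < N) j.+1%:R ^+ m.
Proof.
elim: N => [|N IHN]; first by rewrite big_geq ?power_sum_poly0.
by rewrite -natr1 power_sum_polyS IHN big_nat_recr //= natr1.
Qed.

End ExponentialSeries.

(** * Substitution of the logarithm *)

(* The constant coefficient is [0] because [0^-1 = 0]. *)
Definition log_series n : {poly rat} := \poly_(k < n) ((-1) ^+ k.-1 / k%:R).

Lemma log_series0 n : (log_series n)`_0 = 0.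
Proof. by rewrite coef_poly invr0 mulr0 if_same. Qed.

Lemma coef_mul1DX (u : {poly rat}) k :
  ((1 + 'X) * u^`())`_k = k.+1%:R * u`_k.+1 + k%:R * u`_k.
Proof.
rewrite mulrDl mul1r coefD coefXM !coef_deriv !mulr_natl.
by case: k => [|k]; rewrite ?mulr0n ?addr0.
Qed.

Lemma deriv_log_series n : eqmodX n ((1 + 'X) * (log_series n.+1)^`()) 1.
Proof.
move=> k lt_kn; rewrite coef_mul1DX coef1 !coef_poly ltnS lt_kn leqW //=.
rewrite mulrC divfK ?pnatr_eq0 //; case: k {lt_kn} => [|k]; first by rewrite mul0r addr0.
by rewrite /= mulrC divfK ?pnatr_eq0 // exprS mulN1r addNr.
Qed.

(** The equation (1 + t) u' = c u reads (k+1) u_(k+1) = (c - k) u_k, so precision n in the equation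
    gives precision n+1 in the solution. *)
Lemma eqmodX_deriv_mul1DX n (c : rat) (u v : {poly rat}) : u`_0 = v`_0 ->
  eqmodX n ((1 + 'X) * u^`()) (c *: u) -> eqmodX n ((1 + 'X) * v^`()) (c *: v) ->
  eqmodX n.+1 u v.
Proof.
move=> uv0 Du Dv; elim=> [//|k IHk] lt_kn.
have := Du k lt_kn; have := Dv k lt_kn; rewrite !coef_mul1DX !coefZ IHk ?(ltnW lt_kn) //.
move=> <- /addIr; apply: mulfI; by rewrite pnatr_eq0.
Qed.

Lemma comp_log0 n (u : {poly rat}) : (u \Po log_series n)`_0 = u`_0.
Proof. by rewrite -!horner_coef0 horner_comp (horner_coef0 (log_series n)) log_series0. Qed.

(** Both sides have constant term 1 and solve (1 + t) u' = j u. *)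
Lemma exp_series_comp_log n j :
  eqmodX n.+1 (exp_series n.+1 j%:R \Po log_series n.+1) ((1 + 'X) ^+ j).
Proof.
apply: (@eqmodX_deriv_mul1DX _ j%:R).
- by rewrite comp_log0 coef_poly divr1 -horner_coef0 horner_exp hornerD hornerC hornerX addr0 expr1n.
- rewrite deriv_comp mulrCA -[X in eqmodX _ _ X]mulr1.
  apply: eqmodXM (@deriv_log_series n); rewrite -comp_polyZ.
  apply: eqmodX_comp; first exact: log_series0.
  apply/(@eqmodX_MXn _ n 1); rewrite addn1 expr1 [_ * 'X]mulrC.
  apply: eqmodX_trans (logder_exp_series _) _.
  by rewrite -scalerAl -scalerAl [_ * 'X]mulrC.
case: j => [|j]; first by rewrite expr0 derivC mulr0 scale0r.
rewrite deriv_exp derivD derivC derivX add0r mul1r mulrnAr -exprS scaler_nat.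
exact: eqmodX_refl.
Qed.

Lemma stirling1_0 m : stirling1 0 m = (m == 0)%:R.
Proof. by rewrite /stirling1 big_geq // coef1. Qed.

Lemma stirling1S r m :
  stirling1 r.+1 m = (if m is m'.+1 then stirling1 r m' else 0) + r%:R * stirling1 r m.
Proof.
rewrite /stirling1 big_nat_recr //= mulrDr coefD coefMX coefMC mulrC.
by case: m.
Qed.

Lemma stirling1_gt r m : (r < m)%N -> stirling1 r m = 0.
Proof.
elim: r m => [|r IHr] [|m] //; first by rewrite stirling1_0.
by rewrite ltnS stirling1S => lt_rm; rewrite !IHr ?mulr0 ?addr0 // ltnW.
Qed.

Lemma stirling1_r0 r : (0 < r)%N -> stirling1 r 0 = 0.
Proof.
elim: r => // -[|r] IHr _; rewrite stirling1S add0r ?mul0r // IHr ?mulr0 //.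
Qed.

Lemma stirling1_diag r : stirling1 r r = 1.
Proof. by elim: r => [|r IHr]; rewrite ?stirling1_0 // stirling1S IHr stirling1_gt ?mulr0 ?addr0. Qed.

(** Taking coefficients in (1 + t) (log(1 + t)^m)' = m log(1 + t)^(m-1) gives, up to signs and
    factorials, the recurrence [stirling1S]. *)
Lemma coef_log_series_exp n r m : (r < n)%N ->
  r`!%:R * (log_series n ^+ m)`_r = (-1) ^+ (r + m) * m`!%:R * stirling1 r m.
Proof.
case: n => // n; elim: r m => [|r IHr] m lt_rn.
  rewrite stirling1_0 mul1r -horner_coef0 horner_exp horner_coef0 log_series0.
  by case: m => [|m]; rewrite ?mulr1 ?expr0 ?mulr1 // mulr0 exprS mul0r.
have Dm : eqmodX n ((1 + 'X) * (log_series n.+1 ^+ m)^`()) (m%:R *: log_series n.+1 ^+ m.-1).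
  rewrite (_ : _ * _ = (1 + 'X) * (log_series n.+1)^`() * (m%:R *: log_series n.+1 ^+ m.-1)).
    rewrite -[X in eqmodX _ _ X]mul1r.
    exact: eqmodXM (@deriv_log_series n) (@eqmodX_refl _ _ _).
  by rewrite deriv_exp scaler_nat mulrnAr mulrnAr; congr (_ *+ _); ring.
have := Dm r lt_rn; rewrite coef_mul1DX coefZ => /(congr1 ( *%R r`!%:R)).
rewrite mulrDr mulrCA [in X in _ + X]mulrCA [RHS]mulrCA !IHr ?(ltnW lt_rn) // => D.
rewrite factS natrM -mulrA; move/(canRL (addrK _)): D => ->.
rewrite stirling1S; case: m {Dm} => [|m] /=.
  by rewrite mul0r !addn0 exprS; ring.
by rewrite factS natrM !addSn !addnS !exprS; ring.
Qed.

(** * The expansion of the generating product at [q = 1] *)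

Lemma bernoulli0 : bernoulli 0 = 1.
Proof. by have := bernoulli_rec 0; rewrite big_nat1 mul1r. Qed.

(** The coefficient of z^(i+1), not z^i, in the exponent of F, as a polynomial in x; [p01_coef m] is
    then the coefficient of z^m in F. *)
Definition p01_weight (i : nat) : {poly rat} :=
  ((-1) ^+ i * bernoulli i.+1 / (i.+1%:R * i.+1`!%:R)) *: (power_sum_poly i.+1 - 'X).

Definition p01_coef (m : nat) : {poly rat} := exp_coef p01_weight m.

Lemma P01E r : P01 r = 4 ^+ r *:
  \sum_(0 <= m < r.+1) ((-1) ^+ m * stirling1 r m * m`!%:R) *: p01_coef m.
Proof. by []. Qed.

Definition p01_series n N : {poly rat} := \poly_(m < n) (p01_coef m).[N%:R].

(** In degree k > 0, summing (-1)^k B_k j^k / k! over j <= N produces s_k(N), while the N copies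
    with j = 1 produce N; both sums vanish in degree 0. *)
Lemma logder_p01_series n N :
  logder n.+1 (\sum_(0 <= j < N) (bernoulli_series n.+1 1 - 1) -
     \sum_(0 <= j < N) (bernoulli_series n.+1 j.+1%:R - 1)) (p01_series n.+1 N).
Proof.
pose w i : rat^o := (p01_weight i).[N%:R].
have -> : p01_series n.+1 N = \poly_(m < n.+1) exp_coef (A := rat^o) w m.
  apply/polyP=> m; rewrite !coef_poly; case: ifP => // _.
  exact: (exp_coef_map (horner_eval (N%:R : rat) : {lrmorphism {poly rat} -> rat^o})).
apply: logder_eq (@logder_exp_coef rat^o n w) => k lt_kn.
rewrite coefB !coef_sum coef_poly lt_kn.
under eq_bigr do rewrite coefB coef1 coef_poly lt_kn expr1n mulr1.
under [X in _ - X]eq_bigr do rewrite coefB coef1 coef_poly lt_kn.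
case: k lt_kn => [|k] lt_kn /=.
  by rewrite !big1 ?mul0r ?subrr // => i _; rewrite bernoulli0 invr1 ?mulr1 subrr.
under eq_bigr do rewrite subr0.
under [X in _ - X]eq_bigr do rewrite subr0.
rewrite sumr_const_nat subn0 -[X in _ = X - _]mulr_natr -mulr_sumr -power_sum_poly_nat -mulrBr.
rewrite /w /p01_weight hornerZ hornerD hornerN hornerX exprS.
by field; rewrite nat1r !pnatr_eq0 -lt0n fact_gt0.
Qed.

Lemma p01_seriesE n N : eqmodX n.+1
  (p01_series n.+1 N * \prod_(0 <= j < N) exp_quotient n.+1 j.+1%:R)
  (exp_quotient n.+1 1 ^+ N).
Proof.
pose c := \sum_(0 <= j < N) (bernoulli_series n.+1 1 - 1).
have Q0 d : (exp_quotient n.+1 d)`_0 = 1 by rewrite coef_poly; apply: divr1.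
apply: (@logder_uniq_rat _ c).
- rewrite coef_sum big1 // => j _.
  by rewrite coefB coef1 coef_poly bernoulli0 invr1 !mulr1 subrr.
- rewrite -!horner_coef0 hornerM horner_prod horner_exp !horner_coef0 Q0 expr1n.
  rewrite big1 => [|j _]; last by rewrite horner_coef0 Q0.
  by rewrite coef_poly /p01_coef exp_coef0 hornerC mulr1.
- rewrite -[c](subrK (\sum_(0 <= j < N) (bernoulli_series n.+1 j.+1%:R - 1))).
  apply: logderM (@logder_p01_series n N) _.
  by apply: logder_prod => j; apply: logder_exp_quotient.
rewrite -[N in _ ^+ N]subn0 -prodr_const_nat.
by apply: logder_prod => j; apply: logder_exp_quotient.
Qed.

Definition p01_local n N : {poly rat} := p01_series n N \Po log_series n.

Lemma p01_localE n N : eqmodX n.+1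
  (p01_local n.+1 N * \prod_(0 <= j < N) ((1 + 'X) ^+ j.+1 - 1)) (N`!%:R *: 'X^N).
Proof.
have DE (c : rat) : eqmodX n.+1 (exp_series n.+1 c - 1) (c *: ('X * exp_quotient n.+1 c)).
  rewrite -exp_seriesE; apply: eqmodXB => // k lt_kn.
  by rewrite !coef_poly lt_kn ltnW.
have D : eqmodX n.+1
    (p01_series n.+1 N * \prod_(0 <= j < N) (exp_series n.+1 j.+1%:R - 1))
    (N`!%:R *: (exp_series n.+1 1 - 1) ^+ N).
  (* Each e^(jz) - 1 is j z times its quotient; collecting the factors j z gives N! z^N and leaves
     the product treated by [p01_seriesE]. *)
  apply: eqmodX_trans (_ : eqmodX _ (N`!%:R *: 'X^N * (p01_series n.+1 N *
    \prod_(0 <= j < N) exp_quotient n.+1 j.+1%:R)) _).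
    rewrite (_ : _ *: _ * _ = p01_series n.+1 N *
       \prod_(0 <= j < N) (j.+1%:R *: ('X * exp_quotient n.+1 j.+1%:R))).
      apply: eqmodXM; first exact: eqmodX_refl.
      by apply: eqmodX_prod => j; apply: DE.
    rewrite scaler_prod big_split /= prodr_const_nat subn0 -natr_prod.
    by rewrite fact_prod big_add1 -!scalerAl -!scalerAr; congr (_ *: _); ring.
  apply: eqmodX_trans (eqmodXM (@eqmodX_refl _ _ _) (@p01_seriesE n N)) _.
  rewrite -scalerAl -exprMn -![N`!%:R *: _]mul_polyC.
  apply: eqmodXM; first exact: eqmodX_refl.
  apply: eqmodX_exp; apply: eqmodX_sym.
  by have := DE 1; rewrite scale1r.
have {}D := eqmodX_comp (log_series0 n.+1) D.
rewrite comp_polyM comp_polyZ rmorph_prod rmorphXn /= in D.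
have DX j : eqmodX n.+1 ((exp_series n.+1 j%:R - 1) \Po log_series n.+1) ((1 + 'X) ^+ j - 1).
  rewrite comp_polyB comp_polyC.
  by apply: eqmodXB (@exp_series_comp_log n j) _.
apply: eqmodX_trans (eqmodX_trans _ D) _.
  apply: eqmodXM; first exact: eqmodX_refl.
  by apply: eqmodX_prod => j; apply: eqmodX_sym.
rewrite -!mul_polyC; apply: eqmodXM; first exact: eqmodX_refl.
apply: eqmodX_exp; have := DX 1%N.
by rewrite expr1 [1 + 'X]addrC addrK.
Qed.

(** The terms with m > r vanish with the Stirling numbers. The sign (-1)^(r+m) splits into the
    (-1)^m inside [P01] and the (-1)^r on the right. *)
Lemma p01_local_coef n N r : (r < n)%N ->
  4 ^+ r * (r`!%:R * (p01_local n N)`_r) = (-1) ^+ r * (P01 r).[N%:R].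
Proof.
move=> lt_rn; rewrite P01E hornerZ [RHS]mulrCA; congr (_ * _).
rewrite /p01_local /p01_series poly_def raddf_sum coef_sum mulr_sumr horner_sum mulr_sumr.
rewrite -(big_mkord xpredT (fun m => r`!%:R * (((p01_coef m).[N%:R] *: 'X^m) \Po log_series n)`_r)).
rewrite (big_cat_nat (n := r.+1)) //= [X in _ + X]big_nat_cond [X in _ + X]big1 ?addr0.
  apply: eq_big_nat => m /andP[_ le_mr].
  rewrite comp_polyZ comp_Xn_poly coefZ mulrCA coef_log_series_exp // hornerZ exprD; ring.
move=> m /andP[/andP[lt_rm _] _].
by rewrite comp_polyZ comp_Xn_poly coefZ mulrCA coef_log_series_exp // stirling1_gt ?mulr0.
Qed.

(** * Partial fractions at [q = 1] *)

Section RegularFractions.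
Variables (K : fieldType) (a : K).
Implicit Types (x y : {fraction {poly K}}) (p q : {poly K}).

Lemma tofrac_neq0 p : (tofrac p != 0) = (p != 0).
Proof. by rewrite -tofrac0 tofrac_eq. Qed.

Definition regular_at x :=
  exists p q, q.[a] != 0 /\ x = tofrac p / tofrac q.

Lemma horner_neq0 q : q.[a] != 0 -> q != 0.
Proof. by apply: contraNneq => ->; rewrite horner0. Qed.

Lemma regular_at0 : regular_at 0.
Proof. by exists 0, 1; rewrite hornerC oner_eq0 tofrac0 mul0r. Qed.

Lemma regular_atD x y : regular_at x -> regular_at y -> regular_at (x + y).
Proof.
move=> [p [q [qa ->]]] [p' [q' [q'a ->]]].
exists (p * q' + p' * q), (q * q'); rewrite hornerM mulf_neq0 //; split=> //.
by rewrite addf_div ?tofrac_neq0 ?horner_neq0 // tofracD !tofracM.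
Qed.

Lemma regular_at_sum (I : eqType) (s : seq I) (P : pred I) (F : I -> {fraction {poly K}}) :
  (forall i, i \in s -> P i -> regular_at (F i)) -> regular_at (\sum_(i <- s | P i) F i).
Proof.
move=> regF; rewrite big_seq_cond; apply: big_ind => [|x y|i /andP[si Pi]].
- exact: regular_at0.
- exact: regular_atD.
exact: regF.
Qed.

Lemma regular_at_pole (c b : K) l : b != a ->
  regular_at (tofrac c%:P / (tofrac 'X - tofrac b%:P) ^+ l).
Proof.
move=> ne_ba; exists c%:P, (('X - b%:P) ^+ l).
rewrite horner_exp hornerXsubC expf_neq0 ?subr_eq0 1?eq_sym //; split=> //.
by rewrite -tofracB -tofracXn.
Qed.

(** Clearing denominators, ('X - a)^N divides (u - p w) d, where d is a denominator of [y] with d(a)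
    nonzero, hence coprime to 'X - a. *)
Lemma polar_part_dvd N (u w p : {poly K}) (y : {fraction {poly K}}) :
    w != 0 -> regular_at y ->
    tofrac u / tofrac (('X - a%:P) ^+ N * w) = tofrac p / tofrac (('X - a%:P) ^+ N) + y ->
  ('X - a%:P) ^+ N %| u - p * w.
Proof.
move=> w0 [t [d [da ->]]].
have L0 : ('X - a%:P) ^+ N != 0 by rewrite expf_neq0 ?polyXsubC_eq0.
have d0 := horner_neq0 da.
rewrite addf_div ?tofrac_neq0 // => /eqP.
rewrite eqr_div ?mulf_neq0 ?tofrac_neq0 ?mulf_neq0 // -!(tofracM, tofracD) tofrac_eq.
move=> /eqP D.
have cop : coprimep (('X - a%:P) ^+ N) d.
  by rewrite coprimep_expl // coprimep_sym coprimep_XsubC rootE.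
rewrite -(Gauss_dvdpl _ cop); apply/dvdpP; exists (t * w).
apply: (mulfI L0); rewrite mulrBl mulrBr.
rewrite (_ : _ * (u * d) = u * (('X - a%:P) ^+ N * d)); last by ring.
by rewrite D; ring.
Qed.

End RegularFractions.

Definition cofactor_prod (K : fieldType) N : {poly K} :=
  \prod_(0 <= j < N) \sum_(i < j.+1) 'X^i.

Lemma prod_Xn_sub1 (K : fieldType) N :
  \prod_(0 <= j < N) ('X^(j.+1) - 1) = ('X - 1%:P) ^+ N * cofactor_prod K N.
Proof.
rewrite -[N in _ ^+ N]subn0 -prodr_const_nat -big_split.
by apply: eq_bigr => j _; rewrite /= subrX1.
Qed.

Lemma expi_frac_neq1 (R : realType) h k : (1 < k)%N -> coprime h k -> expi_frac R h k != 1.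
Proof.
move=> k1 co_hk; have prim_k : k.-primitive_root (expi_frac R h k).
  by rewrite expi_frac1X prim_root_exp_coprime // expi_frac_prim // ltnW.
apply: contraTneq k1 => D; rewrite -leqNgt dvdn_leq // (prim_order_dvd prim_k).
by rewrite D expr1n.
Qed.

(** Terms with k >= 2 have their poles at roots of unity other than 1, so the polar part at q = 1 is
    the block k = 1, h = 0. *)
Lemma rademacher_polar_part (R : realType) N : (0 < N)%N ->
  ('X - 1%:P) ^+ N %| (-1) ^+ N -
    (\sum_(1 <= l < N.+1) rademacher R N 0 1 l *: ('X - 1%:P) ^+ (N - l)) *
      cofactor_prod R[i] N.
Proof.
move=> N_gt0; set C := rademacher R N; have := rademacherP R N_gt0; rewrite -/C.
rewrite /rademacher_decomposition /= (prod_invE (@tofrac {poly R[i]})).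
rewrite big_add1 /= prod_Xn_sub1 => D.
pose y := \sum_(2 <= k < N.+1) \sum_(0 <= h < k | coprime h k)
  \sum_(1 <= l < (N %/ k).+1) tofrac (C h k l)%:P / (tofrac 'X - tofrac (expi_frac R h k)%:P) ^+ l.
apply: (@polar_part_dvd _ 1 N ((-1) ^+ N) _ _ y).
- rewrite prodf_seq_neq0; apply/allP => j _ /=.
  have: ('X^(j.+1) - 1%:P : {poly R[i]}) != 0 by rewrite -size_poly_gt0 size_XnsubC.
  by rewrite subrX1; apply: contraNneq => ->; rewrite mulr0.
- apply: regular_at_sum => k; rewrite mem_index_iota => /andP[k_gt1 _] _.
  apply: regular_at_sum => h _ co_hk; apply: regular_at_sum => l _ _.
  by apply: regular_at_pole; apply: expi_frac_neq1.
apply: etrans D _; rewrite big_ltn //; congr (_ + _).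
rewrite big_mkcond big_nat1 coprimen1 divn1 rmorph_sum mulr_suml.
apply: eq_big_nat => l /andP[_]; rewrite ltnS => le_lN.
rewrite expi_frac0 -tofracB -mul_polyC rmorphM !rmorphXn -mulrA; congr (_ * _).
rewrite -{2}(subnK le_lN) exprD invfM mulrA divff ?mul1r //.
by rewrite expf_neq0 // tofrac_neq0 polyXsubC_eq0.
Qed.

(** * Degree, leading coefficient and roots *)

Lemma bernoulli1 : bernoulli 1 = - 2^-1.
Proof.
have := bernoulli_rec 1; rewrite big_mkord !big_ord_recr big_ord0 /= bernoulli0.
rewrite bin0 bin1 add0r mulr1 => /(canRL (addKr _)) D.
by apply: (mulfI (_ : 2 != 0)) => //; rewrite D mulrN divff ?addr0.
Qed.

Lemma coef_power_sum_poly m i : (power_sum_poly m)`_i.+1 =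
  if (i <= m)%N then m.+1%:R^-1 * ('C(m.+1, i.+1)%:R * (-1) ^+ (m - i) * bernoulli (m - i))
  else 0.
Proof.
rewrite /power_sum_poly coefZ coef_sum big_mkord; case: leqP => [le_im|lt_mi].
  rewrite (bigD1 (inord i)) //= inordK // coefZ coefXn eqxx mulr1 big1 ?addr0 // => j ne_ji.
  rewrite coefZ coefXn eqSS (_ : i == j = false) ?mulr0 //.
  by apply: contraNF ne_ji => /eqP ->; rewrite inord_val.
rewrite big1 ?mulr0 // => j _; rewrite coefZ coefXn eqSS gtn_eqF ?mulr0 //.
by rewrite (leq_trans _ lt_mi).
Qed.

Lemma p01_weight_gt i k : (i.+2 < k)%N -> (p01_weight i)`_k = 0.
Proof.
case: k => // k lt_ik; rewrite coefZ coefB coef_power_sum_poly coefX.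
by rewrite ifN ?gtn_eqF ?subrr ?mulr0 //; lia.
Qed.

Lemma p01_weight0_2 : (p01_weight 0)`_2 = - 4^-1.
Proof.
by rewrite coefZ coefB coef_power_sum_poly coefX /= subnn binn bernoulli0 bernoulli1.
Qed.

Lemma horner_p01_weight i x : x = 0 \/ x = 1 -> (p01_weight i).[x] = 0.
Proof.
rewrite hornerZ hornerD hornerN hornerX => -[] ->.
  by rewrite power_sum_poly0 subrr mulr0.
by rewrite -[1]/(1%:R) power_sum_poly_nat big_nat1 expr1n subrr mulr0.
Qed.

Lemma p01_coefS m : p01_coef m.+1 *+ m.+1 =
  \sum_(i < m.+1) i.+1%:R * p01_weight i * p01_coef (m - i).
Proof. exact: exp_coef_rec. Qed.

(** In the recursion for index m+1, the term of index i has degree at most (i + 2) + 2 (m - i) <= 2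
    (m + 1). *)
Lemma p01_coef_gt m k : (2 * m < k)%N -> (p01_coef m)`_k = 0.
Proof.
elim/ltn_ind: m k => -[|m] IHm k lt_mk.
  by rewrite /p01_coef exp_coef0 coef1 gtn_eqF // ltnW.
apply: (mulIf (_ : m.+1%:R != 0)); first by rewrite pnatr_eq0.
rewrite mul0r mulr_natr -coefMn p01_coefS coef_sum big1 // => i _.
rewrite -mulrA mulr_natl coefMn coefM big1 ?mul0rn // => j _.
have [le_ji|lt_ij] := leqP j i.+2; last by rewrite p01_weight_gt // mul0r.
rewrite [X in _ * X]IHm ?mulr0 ?ltnS ?leq_subr //.
have := ltn_ord i; have := ltn_ord j; lia.
Qed.

Lemma p01_coef_top m : (p01_coef m)`_(2 * m) = (- 4^-1) ^+ m / m`!%:R.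
Proof.
elim: m => [|m IHm].
  by rewrite muln0 /p01_coef exp_coef0 coef1 divr1.
apply: (mulIf (_ : m.+1%:R != 0)); first by rewrite pnatr_eq0.
rewrite mulr_natr -coefMn p01_coefS coef_sum big_ord_recl subn0 mul1r big1 ?addr0.
  (* Degree 2(m+1) is reached only by the term i = 0, through the x^2 coefficient -1/4 of
     [p01_weight 0]; a term with i > 0 falls short by at least i. *)
  rewrite coefM (bigD1 (inord 2)) //= inordK; last by lia.
  rewrite p01_weight0_2 mulnS addKn IHm big1 ?addr0.
    rewrite factS natrM exprS; field.
    by rewrite nat1r !pnatr_eq0 -lt0n fact_gt0.
  move=> j ne_j2; have [lt2j|le_j2] := ltnP 2 j; first by rewrite p01_weight_gt // mul0r.
  rewrite [X in _ * X]p01_coef_gt ?mulr0 //.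
  have: (j != 2 :> nat)%N by apply: contraNneq ne_j2 => D; apply/eqP/val_inj; rewrite /= inordK //; lia.
  by have := ltn_ord j; lia.
move=> i _; rewrite -mulrA mulr_natl coefMn coefM big1 ?mul0rn // => j _.
have [le_ji|lt_ij] := leqP j (lift ord0 i).+2; last by rewrite p01_weight_gt // mul0r.
rewrite [X in _ * X]p01_coef_gt ?mulr0 //.
have := ltn_ord i; have := ltn_ord j; move: le_ji; rewrite lift0; lia.
Qed.

Lemma horner_p01_coef m x : x = 0 \/ x = 1 -> (0 < m)%N -> (p01_coef m).[x] = 0.
Proof.
case: m => // m x01 _; apply: (mulIf (_ : m.+1%:R != 0)); first by rewrite pnatr_eq0.
rewrite mul0r mulr_natr -hornerMn p01_coefS horner_sum big1 // => i _.
by rewrite !hornerM horner_p01_weight // mulr0 mul0r.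
Qed.

Lemma coef_P01 r k : (P01 r)`_k =
  4 ^+ r * \sum_(0 <= m < r.+1) (-1) ^+ m * stirling1 r m * m`!%:R * (p01_coef m)`_k.
Proof.
by rewrite P01E coefZ coef_sum; under eq_bigr do rewrite coefZ.
Qed.

(** Only m = r reaches degree 2r, and 4^r (-1)^r r! (-1/4)^r / r! = 1. *)
Lemma coef_P01_top r : (P01 r)`_(2 * r) = 1.
Proof.
rewrite coef_P01 big_nat_recr //= big_nat big1 => [|m /andP[_ lt_mr]]; last first.
  by rewrite p01_coef_gt ?mulr0 // ltn_pmul2l.
rewrite add0r stirling1_diag p01_coef_top mulr1.
have r0 : r`!%:R != 0 :> rat by rewrite pnatr_eq0 -lt0n fact_gt0.
transitivity ((4 * (-1) * (- 4^-1)) ^+ r : rat).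
  by rewrite !exprMn -!mulrA (mulrCA r`!%:R) divff // mulr1.
by rewrite mulrN1 mulrNN divff ?expr1n // pnatr_eq0.
Qed.

Lemma size_P01 r : size (P01 r) = (2 * r).+1.
Proof.
apply/eqP; rewrite eqn_leq; apply/andP; split.
  apply/leq_sizeP => k lt_rk; rewrite coef_P01 big_nat big1 ?mulr0 // => m /andP[_ le_mr].
  rewrite p01_coef_gt ?mulr0 // (leq_ltn_trans _ lt_rk) // leq_pmul2l //.
rewrite ltnNge; apply/negP=> /leq_sizeP /(_ _ (leqnn _)) /eqP.
by rewrite coef_P01_top oner_eq0.
Qed.

Lemma monic_P01 r : P01 r \is monic.
Proof. by rewrite monicE lead_coefE size_P01 /= coef_P01_top. Qed.

(** The term m = 0 disappears because [stirling1 r 0] is 0 for positive r; the others vanish because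
    every s_i(x) - x does at 0 and 1. *)
Lemma root_P01 r x : (0 < r)%N -> x = 0 \/ x = 1 -> root (P01 r) x.
Proof.
move=> r0 x01; rewrite rootE P01E hornerZ horner_sum big_nat_recl //.
rewrite stirling1_r0 // mulr0 mul0r scale0r horner0 add0r big1 ?mulr0 // => m _.
by rewrite hornerZ horner_p01_coef // mulr0.
Qed.

(** * Comparison of the two expansions *)

Lemma rademacher_polar_part_shift (R : realType) N : (0 < N)%N ->
  eqmodX N ((-1) ^+ N)
    ((\sum_(1 <= l < N.+1) rademacher R N 0 1 l *: 'X^(N - l)) *
       (cofactor_prod R[i] N \Po (1 + 'X))).
Proof.
move=> /(rademacher_polar_part R) /dvdpP[t /(canRL (subrK _))].
move=> /(congr1 (comp_poly (1 + 'X))).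
have shiftX k : ('X - 1%:P) ^+ k \Po (1 + 'X) = 'X^k :> {poly R[i]}.
  by rewrite rmorphXn /= comp_polyB comp_polyX comp_polyC addrC addKr.
rewrite rmorphXn rmorphN1 comp_polyD 2!comp_polyM shiftX addrC => D.
apply: eqmodX_dvd; rewrite {1}D; congr (_ * _ + _).
by rewrite raddf_sum; apply: eq_bigr => l _; rewrite /= comp_polyZ shiftX.
Qed.

(** Both sides of [p01_localE] are multiples of t^N, and cancelling it costs N orders of precision;
    hence the truncation at N + r + 1 for a result modulo t^(r+1). *)
Lemma p01_local_cofactor (K : numFieldType) N r :
  eqmodX r.+1 (map_poly ratr (p01_local (N + r).+1 N) * (cofactor_prod K N \Po (1 + 'X)))
    (N`!%:R%:P).
Proof.
apply/(@eqmodX_MXn _ r.+1 N) => k; rewrite addSnnS addnC addSn => lt_k.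
have := congr1 (ratr : rat -> K) (p01_localE N lt_k).
rewrite -!coef_map rmorphM map_polyZ /= map_polyXn ratr_nat mul_polyC => <-.
rewrite -mulrA; congr (nth 0 (polyseq _) k); congr (_ * _).
transitivity (\prod_(0 <= j < N) ('X^(j.+1) - 1) \Po (1 + 'X) : {poly K}).
  rewrite prod_Xn_sub1 comp_polyM rmorphXn /= comp_polyB comp_polyX comp_polyC.
  by rewrite [1 + 'X in X in X - 1]addrC addrK mulrC.
rewrite !rmorph_prod; apply: eq_bigr => j _ /=.
rewrite comp_polyB comp_Xn_poly comp_polyC rmorphB rmorphXn rmorphD /= map_polyX.
by rewrite !rmorph1.
Qed.

Lemma rademacher_p01_local (R : realType) N r : (r < N)%N ->
  N`!%:R * rademacher R N 0 1 (N - r) = (-1) ^+ N * ratr (p01_local (N + r).+1 N)`_r.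
Proof.
move=> lt_rN; have N_gt0 : (0 < N)%N := leq_ltn_trans (leq0n r) lt_rN.
have := rademacher_polar_part_shift R N_gt0; have := @p01_local_cofactor R[i] N r.
set W := _ \Po _; set P := \sum_(_ <- _) _; set G := map_poly _ _ => DG DP.
(* From G W = N! and P W = (-1)^N one gets N! P = G W P = (-1)^N G. The second congruence holds
   modulo t^N, which suffices as r < N; the coefficient of t^r in P is the one with l = N - r. *)
have PGW : eqmodX r.+1 (N`!%:R%:P * P) ((-1) ^+ N * G).
  apply: eqmodX_trans (eqmodXM (eqmodX_sym DG) (@eqmodX_refl _ _ P)) _.
  rewrite -mulrA [W * P]mulrC [G * _]mulrC.
  exact: eqmodXM (eqmodX_sym (eqmodX_leq lt_rN DP)) (@eqmodX_refl _ _ _).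
have := PGW r (ltnSn r); rewrite coefCM coef_sum.
rewrite (bigD1_seq (N - r)%N) ?iota_uniq ?mem_index_iota ?subn_gt0 ?lt_rN ?ltnS ?leq_subr //=.
rewrite coefZ coefXn subKn ?(ltnW lt_rN) // eqxx mulr1 big_seq_cond big1 ?addr0.
  by move=> ->; rewrite -[in RHS]signr_odd -signr_odd !mulr_sign; case: odd;
     rewrite ?coefN coef_map.
move=> l /andP[+ ne_l]; rewrite mem_index_iota ltnS => /andP[_ le_lN].
rewrite coefZ coefXn (_ : _ == _ = false) ?mulr0 //; apply: contraNF ne_l => /eqP ->.
by rewrite subKn.
Qed.

Theorem theorem7p3 (R : realType) (r : nat) (r_ge1 : (1 <= r)%N) :
  (forall N : nat, (r.+1 <= N)%N ->
     ratr (P01 r).[N%:R] =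
     (-1) ^+ N * N`!%:R * (-4) ^+ r * r`!%:R * rademacher R N 0 1 (N - r)%N) /\
  P01 r \is monic /\
  size (P01 r) = (2 * r)%N.+1 /\
  root (P01 r) 0 /\
  root (P01 r) 1.
Proof.
split; last first.
  split; first exact: monic_P01.
  split; first exact: size_P01.
  by split; apply: root_P01 => //; [left | right].
move=> N lt_rN.
have lt_r : (r < (N + r).+1)%N by rewrite ltnS leq_addl.
have := congr1 ( *%R ((-1) ^+ r)) (p01_local_coef N lt_r).
rewrite signrMK => <-.
have -> : (-4) ^+ r = (-1) ^+ r * 4 ^+ r :> R[i] by rewrite -exprMn mulN1r.
rewrite !rmorphM !rmorphXn rmorphN1 /= !ratr_nat.
have := congr1 ( *%R ((-1) ^+ N)) (rademacher_p01_local R lt_rN).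
rewrite signrMK => <-; ring.
Qed.
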